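(* Let $n\ge1$ and let $\beta$ be a non-zero element of $K_-$. The field $\tilde T_{n+2}$ is generated over $T_1$ by the set of elements $$\{\,u_{c,\xi}\;:\;c\in K_-^{\,n-1},\ \xi\in\{0,\beta\}\,\}.$$
   Context: Let $p$ be an odd prime, $K=\mathbb{F}_{p^2}$, and $K_-=\{\alpha\in K:\alpha^p=-\alpha\}$. Put $g(x)=x^{p+1}/(x^p+x)\in\mathbb{F}_p(x)$. Let $T_1=K(x_1)$ be the rational function field, and, inside a fixed separable closure $\Omega$ of $T_1$, define recursively $T_m=K(x_1,\dots,x_m)$, where $x_{i+1}$ is a root of $x_{i+1}^p+x_{i+1}=g(x_i)$. Let $\tilde T_n\subset\Omega$ be the Galois closure of $T_n$ over $T_1$. Elements $u_c\in\Omega$: for $c=c_1\in K_-$, $u_{c_1}$ denotes a (chosen) root of $X^p+X-g(x_2+c_1)$; for $m\ge2$ and $c=(c_1,\dots,c_m)\in K_-^m$, with $c'=(c_1,\dots,c_{m-1})$, $u_c$ denotes a (chosen) root of $X^p+X-g(u_{c'}+c_m)$. For $c=(c_1,\dots,c_{n-1})\in K_-^{n-1}$ and $\xi\in K_-$, $u_{c,\xi}$ means $u_{(c_1,\dots,c_{n-1},\xi)}$ (when $n=1$, $c$ is empty and $u_{c,\xi}=u_\xi$). *)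

(* Defs.v *)
From HB Require Import structures.
From mathcomp Require Import all_boot all_order all_algebra separable.
From mathcomp Require Import boolp classical_sets.

Set Implicit Arguments.
Unset Strict Implicit.
Unset Printing Implicit Defensive.

Import GRing.Theory.
Local Open Scope ring_scope.
Local Open Scope classical_set_scope.

Section Subfields.
Variable L : fieldType.

Definition is_subfield (M : set L) : Prop := GRing.divring_closed [in M].

Definition subfield_gen (A : set L) : set L := smallest is_subfield A.

End Subfields.

(* Possibly infinite extensions: L is viewed as an extension of F through a
   field morphism iota : F -> L, and intermediate fields are subsets of L. *)
Section Extensions.
Variables (F L : fieldType) (iota : {rmorphism F -> L}).

Definition adjoin (A : set L) : set L := subfield_gen (range iota `|` A).

Definition is_intermediate (M : set L) : Prop :=
  is_subfield M /\ range iota `<=` M.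

(* y is algebraic over F and its minimal polynomial is separable. *)
Definition separable_elt (y : L) : Prop :=
  exists q : {poly F}, [/\ irreducible_poly q, separable_poly q
                         & root (map_poly iota q) y].

Definition separable_over (M : set L) : Prop :=
  forall y, M y -> separable_elt y.

Definition splits_in (M : set L) (q : {poly L}) : Prop :=
  exists2 rs : seq L, (forall r, r \in rs -> M r)
                    & q %= \prod_(r <- rs) ('X - r%:P).

(* Algebraicity, usually part of normality, is supplied by separability in
   galois_over below. *)
Definition normal_over (M : set L) : Prop :=
  forall q : {poly F}, irreducible_poly q ->
    (exists2 y, M y & root (map_poly iota q) y) ->
    splits_in M (map_poly iota q).

Definition galois_over (M : set L) : Prop :=
  [/\ is_intermediate M, separable_over M & normal_over M].

Definition galois_closure (M : set L) : set L := smallest galois_over M.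

Definition separable_closure : Prop :=
  separable_over [set: L] /\
  forall q : {poly L}, separable_poly q -> (1 < size q)%N ->
    exists y, root q y.

End Extensions.

Definition Kminus (p : nat) (K : fieldType) : {pred K} :=
  [pred a : K | a ^+ p == - a].
Arguments Kminus p K : clear implicits.

Definition g (p : nat) (L : fieldType) (y : L) : L :=
  y ^+ p.+1 / (y ^+ p + y).

(* X^p + X - g(y) *)
Definition step_poly (p : nat) (L : fieldType) (y : L) : {poly L} :=
  'X^p + 'X - (g p y)%:P.

(* The rational function field K(x_1), with x_1 the class of 'X. *)
Notation ratfun K := {fraction {poly K}}.

Definition ratfun_X (K : fieldType) : ratfun K := tofrac 'X.

Definition ratfun_C (K : fieldType) (a : K) : ratfun K := tofrac a%:P.

Section Tower.
Variables (p : nat) (K Omega : fieldType).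
Variable iota : {rmorphism ratfun K -> Omega}.

Definition constK (a : K) : Omega := iota (ratfun_C a).

(* The sequence x_1, x_2, ...; the value x 0 is irrelevant. *)
Definition tower_seq (x : nat -> Omega) : Prop :=
  x 1%N = iota (ratfun_X K) /\
  forall i, (0 < i)%N -> root (step_poly p (x i)) (x i.+1).

Definition T (x : nat -> Omega) (m : nat) : set Omega :=
  subfield_gen (range constK `|` [set x i | i in [set i | (0 < i <= m)%N]]).

(* u [:: c_1; ...; c_m] is a chosen u_(c_1,...,c_m); the values of u at [::]
   and at sequences with an entry outside Kminus are irrelevant. *)
Definition u_family (x : nat -> Omega) (u : seq K -> Omega) : Prop :=
  (forall c1, c1 \in Kminus p K ->
     root (step_poly p (x 2%N + constK c1)) (u [:: c1])) /\
  (forall (c' : seq K) (cm : K), c' != [::] ->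
     {subset c' <= Kminus p K} -> cm \in Kminus p K ->
     root (step_poly p (u c' + constK cm)) (u (rcons c' cm))).

End Tower.

(* Main.v *)
Require Import Defs.
From HB Require Import structures.
From mathcomp Require Import all_boot all_order all_algebra separable.
From mathcomp Require Import boolp classical_sets.
From mathcomp Require Import finfield ring.

Set Implicit Arguments.
Unset Strict Implicit.
Unset Printing Implicit Defensive.

Import GRing.Theory.
Local Open Scope ring_scope.
Local Open Scope classical_set_scope.

(** Write P(w) = w^p + w, so that x_(i+1) and the u_c are solutions of
    P(s) = g(t), and let F be the field generated by the u_(c,xi) with xi in
    {0, beta}. Call level k the set of all u_d + xi with d of length k and xi
    in K_- (x_2 stands for u_d when d is empty). As K_- is the kernel of P,
    level k+1 consists of all solutions of P(s) = g(t) with t in level k, and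
    level 0 of the solutions of P(s) = g(x_1). Three facts are needed.

    F contains the levels 0, ..., n. This rests on two identities:
    g(t + c) = g(t) + c - (2ct + c^2) / P(t) for c in K_-, and
    P(1/w) = 1/g(w). By the first, two values g(t) and g(t + beta) determine
    t up to a quadratic equation, and they also determine
    (t + beta/2)^(p-1); since t is not constant, these two conditions force t
    into the field of the two values ([g_step_descent]), which descends the
    tower from one level to the one below. By both identities, if
    P(t) = g(w), then g(t + k beta) with k in F_p differs from
    g(t) + k (g(t + beta) - g(t)) by P of a multiple of 1/w
    ([g_step_span]), so that the solutions for xi = 0 and xi = beta yield
    those for all xi.

    F is Galois over T_1. A conjugate of an element of F is its image under an
    embedding over T_1 of a finitely generated field containing F
    ([embedding_extension]); an embedding preserves the equations
    P(s) = g(t), hence maps each level into itself and F into F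
    ([normal_generators]).

    A Galois extension of T_1 containing x_(n+2) contains level n. The
    conjugates of x_(n+2) lie in level n, which has at most p^(n+1) elements,
    so it is enough that x_(n+2) has degree at least p^(n+1) over T_1: the
    conjugates then fill the level ([level_sub_galois]). The degree bound
    holds because the pole of x_1 is totally ramified in the tower: with
    y_i = 1/x_i, the power y_(m+1)^(p^m) is y_1 times an element that is 1 at
    the place y_1 = ... = y_(m+1) = 0. In a relation over T_1 between powers
    of x_(m+1) of exponents below p^m, the orders at this place of any two
    terms would differ, so one term would dominate all the others
    ([tower_relation_degree]). The place is represented by an ideal of the
    integral closure of K[y_1] ([at_place]); it is proper because x_1 is not
    integral over K[y_1]. *)

(** * Subfields given as sets *)
Section SubfieldTheory.
Variables (L : fieldType) (M : set L).
Hypothesis subM : is_subfield M.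

Lemma subfield1 : M 1.
Proof. by case: subM => + _ _; rewrite inE. Qed.

Lemma subfieldB a b : M a -> M b -> M (a - b).
Proof. by case: subM => _ + _ Ma Mb => /(_ a b); rewrite !inE; apply. Qed.

Lemma subfield_div a b : M a -> M b -> M (a / b).
Proof. by case: subM => _ _ + Ma Mb => /(_ a b); rewrite !inE; apply. Qed.

Lemma subfield0 : M 0.
Proof. by rewrite -(subrr 1); apply: subfieldB; apply: subfield1. Qed.

Lemma subfieldN a : M a -> M (- a).
Proof. by rewrite -[- a]sub0r; apply: subfieldB; apply: subfield0. Qed.

Lemma subfieldD a b : M a -> M b -> M (a + b).
Proof. by move=> Ma Mb; rewrite -[b]opprK; apply/subfieldB/subfieldN. Qed.

Lemma subfieldV a : M a -> M a^-1.
Proof. by rewrite -[a^-1]div1r; apply: subfield_div; apply: subfield1. Qed.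

Lemma subfieldM a b : M a -> M b -> M (a * b).
Proof. by move=> Ma Mb; rewrite -[b]invrK; apply/subfield_div/subfieldV. Qed.

Lemma subfieldX a k : M a -> M (a ^+ k).
Proof.
move=> Ma; elim: k => [|k IHk]; first exact: subfield1.
by rewrite exprS; apply: subfieldM.
Qed.

Lemma subfield_horner (q : {poly L}) a :
  (forall i, M q`_i) -> M a -> M q.[a].
Proof.
move=> Mq Ma; rewrite horner_coef; apply: (big_ind M) => [|b c|i _].
- exact: subfield0.
- exact: subfieldD.
- exact/subfieldM/subfieldX.
Qed.

End SubfieldTheory.

Lemma is_subfieldP (L : fieldType) (M : set L) :
  M 1 -> (forall a b, M a -> M b -> M (a - b)) ->
  (forall a b, M a -> M b -> M (a * b)) -> (forall a, M a -> M a^-1) ->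
  is_subfield M.
Proof.
move=> M1 MB MM MV; split; rewrite ?inE // => a b; rewrite !inE => Ma Mb.
  exact: MB.
by apply: MM => //; apply: MV.
Qed.

Lemma subfield_gen_subfield (L : fieldType) (A : set L) :
  is_subfield (subfield_gen A).
Proof.
apply: is_subfieldP => [|a b|a b|a] => [M [sM _]|Ma Mb M sAM|Ma Mb M sAM|Ma M sAM].
- exact: subfield1 sM.
- by apply: (subfieldB (proj1 sAM)); [apply: Ma|apply: Mb].
- by apply: (subfieldM (proj1 sAM)); [apply: Ma|apply: Mb].
- by apply: (subfieldV (proj1 sAM)); apply: Ma.
Qed.

(** * Conjugates and embeddings over a base field *)
Section Conjugation.
Variables (F L : fieldType) (iota : {rmorphism F -> L}).
Local Notation "q ^f" := (map_poly iota q).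
Implicit Types (q h : {poly F}) (y z : L).

(** An irreducible polynomial that is not coprime to [h] divides it, and two
    polynomials with a common root are not coprime. *)
Lemma irreducible_root_dvdp q h y :
  irreducible_poly q -> root q^f y -> root h^f y = (q %| h).
Proof.
move=> [_ irr_q] qy; apply/idP/idP => [hy|/dvdpP[k ->]]; last first.
  by rewrite rmorphM rootM qy orbT.
have [cop|ncop] := boolP (coprimep q h).
  by have := coprimep_root (etrans (coprimep_map iota q h) cop) qy; rewrite -rootE hy.
have /irr_q/(_ (dvdp_gcdl _ _)) : size (gcdp q h) != 1%N by [].
by move/andP=> [_ /dvdp_trans]; apply; apply: dvdp_gcdr.
Qed.

Definition conjugates z z' := forall q, root q^f z = root q^f z'.

Lemma irreducible_conjugates q z z' :
  irreducible_poly q -> root q^f z -> root q^f z' -> conjugates z z'.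
Proof. by move=> irr_q qz qz' h; rewrite !(irreducible_root_dvdp h irr_q). Qed.

(** For algebraic [z] this is the field generated by [z]: see
    [poly_values_subfield], where inverses come from a Bezout relation with the
    minimal polynomial of [z]. *)
Definition poly_values z : set L := [set w | exists h, h^f.[z] = w].

Hypothesis sepcl : separable_closure iota.

Lemma elt_separable z :
  exists q, [/\ irreducible_poly q, separable_poly q & root q^f z].
Proof. by case: sepcl => + _; apply. Qed.

Lemma irreducible_separable q z :
  irreducible_poly q -> root q^f z -> separable_poly q.
Proof.
move=> irr_q qz; have [r [irr_r sep_r rz]] := elt_separable z.
by apply: dvdp_separable sep_r; rewrite -(irreducible_root_dvdp r irr_q qz).
Qed.

Lemma separable_splits (q : {poly L}) :
  separable_poly q -> exists2 rs, uniq rs & q %= \prod_(r <- rs) ('X - r%:P).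
Proof.
have [n] := ubnP (size q); elim: n q => // n IHn q ltqn sep_q.
have [lt1q|le_q1] := ltnP 1 (size q); last first.
  exists [::] => //; rewrite big_nil -size_poly_eq1 eqn_leq le_q1.
  by rewrite size_poly_gt0 separable_poly_neq0.
have [y /factor_theorem[k Dq]] := (proj2 sepcl) q sep_q lt1q.
have nzk : k != 0.
  by apply: contraTneq (separable_poly_neq0 sep_q) => k0; rewrite Dq k0 mul0r eqxx.
have sep_k : separable_poly k by apply: dvdp_separable sep_q; rewrite Dq dvdp_mulr.
have [|rs _ eqk] := IHn k _ sep_k.
  by rewrite Dq size_Mmonic ?monicXsubC // size_XsubC addn2 in ltqn.
have eqq : q %= \prod_(r <- y :: rs) ('X - r%:P).
  by rewrite Dq big_cons mulrC eqp_mul2l // polyXsubC_eq0.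
by exists (y :: rs); rewrite // -separable_prod_XsubC -(eqp_separable eqq).
Qed.

Lemma poly_values_subfield z : is_subfield (poly_values z).
Proof.
apply: is_subfieldP => [|_ _ [h <-] [k <-]|_ _ [h <-] [k <-]|_ [h <-]].
- by exists 1; rewrite rmorph1 hornerC.
- by exists (h - k); rewrite rmorphB !hornerE.
- by exists (h * k); rewrite rmorphM !hornerE.
have [r [irr_r _ rz]] := elt_separable z.
have [hz0|nzhz] := eqVneq (h^f.[z]) 0.
  by exists 0; rewrite hz0 invr0 rmorph0 horner0.
have: coprimep r h.
  apply: contraNT nzhz => ncop; rewrite -rootE (irreducible_root_dvdp h irr_r rz).
  case: irr_r => _ /(_ _ ncop (dvdp_gcdl _ _)) /andP[_ /dvdp_trans]; apply.
  exact: dvdp_gcdr.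
case/Bezout_eq1_coprimepP => -[u v] /= Duv; exists v.
have /(congr1 (fun q => q^f.[z])) := Duv.
rewrite rmorphD !rmorphM rmorph1 !hornerE (rootP rz) mulr0 add0r => Dv.
by apply: (mulIf nzhz); rewrite Dv mulVf.
Qed.

Lemma poly_values_iota z a : poly_values z (iota a).
Proof. by exists a%:P; rewrite map_polyC hornerC. Qed.

(** The resultant in X of the minimal polynomial r(X) of [z] and of h(X) - Y
    is a polynomial in Y over the base field that vanishes at Y = h(z), since
    [z] is then a common root. It hence vanishes at every conjugate [y'] of
    h(z), so that r(X) and h(X) - y' have a common root [z']. *)
Lemma conjugate_lift q h z y' :
    irreducible_poly q -> root q^f h^f.[z] -> root q^f y' ->
  exists2 z', conjugates z z' & h^f.[z'] = y'.
Proof.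
move=> irr_q qy qy'; have [r [irr_r sep_r rz]] := elt_separable z.
have [lth1|lt1h] := leqP (size h) 1.
  have Dh := size1_polyC lth1; exists z => //.
  rewrite Dh map_polyC hornerC in qy *.
  have: root ('X - (h`_0)%:P)^f y'.
    rewrite -(irreducible_conjugates irr_q qy qy') map_polyXsubC root_XsubC.
    by rewrite /= eqxx.
  by rewrite map_polyXsubC root_XsubC /= => /eqP.
pose ev (y : L) : {rmorphism {poly F} -> L} := horner_eval y \o map_poly iota.
pose R := r^:P; pose H : {poly {poly F}} := h^:P - 'X%:P.
have szH : size H = size h.
  rewrite size_polyDl size_map_polyC // size_polyN.
  by rewrite size_polyC polyX_eq0.
have lcR y : ev y (lead_coef R) != 0.
  rewrite lead_coef_map_inj ?rmorph0 //; last exact: polyC_inj.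
  rewrite /ev /= map_polyC /horner_eval hornerC fmorph_eq0 lead_coef_eq0.
  by case: irr_r => lt1r _; rewrite -size_poly_gt0 ltnW.
have lcH y : ev y (lead_coef H) != 0.
  rewrite lead_coefE szH coefB coef_map coefC /=.
  have -> : ((size h).-1 == 0)%N = false by case: (size h) lt1h => [|[]].
  rewrite subr0 /ev /= map_polyC /horner_eval hornerC fmorph_eq0 -lead_coefE.
  by rewrite lead_coef_eq0 -size_poly_gt0 ltnW.
have evC y (k : {poly F}) : map_poly (ev y) k^:P = k^f.
  rewrite -map_poly_comp; apply: eq_map_poly => a.
  by rewrite /ev /= map_polyC /horner_eval hornerC.
have evR y : root (resultant R H)^f y = (1 < size (gcdp r^f (h^f - y%:P)))%N.
  rewrite -resultant_eq0 rootE -[_^f.[y]]/(ev y (resultant R H)).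
  rewrite map_resultant //; congr (resultant _ _ == 0); first exact: evC.
  rewrite rmorphB /= evC map_polyC /=; congr (_ - _%:P).
  by rewrite /ev /= map_polyX /horner_eval hornerX.
have: root (resultant R H)^f y'.
  rewrite -(irreducible_conjugates irr_q qy qy') evR.
  have: 'X - z%:P %| gcdp r^f (h^f - (h^f.[z])%:P).
    by rewrite dvdp_gcd !dvdp_XsubCl rz /root !hornerE subrr eqxx.
  move/dvdp_leq; rewrite size_XsubC; apply.
  by rewrite gcdp_eq0 map_poly_eq0 negb_and (separable_poly_neq0 sep_r).
rewrite evR => lt1g.
have [||z'] := (proj2 sepcl) (gcdp r^f (h^f - y'%:P)).
- apply: (dvdp_separable (dvdp_gcdl _ _)).
  by rewrite separable_map.
- exact: lt1g.
rewrite root_gcd => /andP[rz' hz'].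
exists z'; first exact: irreducible_conjugates irr_r rz rz'.
by move: hz'; rewrite /root !hornerE subr_eq0 => /eqP.
Qed.

Hypothesis infF : forall k, exists2 s : seq F, uniq s & size s = k.

(** Adjoins the elements of [l] one at a time: as the base field is infinite,
    some combination a w - z avoids the finitely many values excluded by the
    two-generator case [large_field_PET]. *)
Lemma primitive_element (l : seq L) :
  exists z, forall w, w \in l -> poly_values z w.
Proof.
elim: l => [|w l [z Dz]]; first by exists 0.
have [r [irr_r sep_r rz]] := elt_separable z.
have [q [_ sep_q qw]] := elt_separable w.
have [P nzP PET] := large_field_PET (separable_poly_neq0 sep_r) rz qw sep_q.
have [s uniq_s szs] := infF (size P).
have /allPn[a] : ~~ all (root P) (map iota s).
  apply/negP => /(max_poly_roots nzP); rewrite map_inj_uniq ?size_map ?szs ?ltnn.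
    by move/(_ uniq_s).
  exact: fmorph_inj.
case/mapP=> t _ -> /PET[zz zw]; exists (iota t * w - z) => v.
rewrite inE => /orP[/eqP-> //|/Dz[k <-]].
apply: (subfield_horner (poly_values_subfield _)) zz => i.
by rewrite coef_map; apply: poly_values_iota.
Qed.

(** A field morphism over the base field defined on [D], encoded as a function
    on the whole of [L] whose values outside [D] are arbitrary. *)
Definition embeds_on (D : set L) (s : L -> L) :=
  [/\ forall a, s (iota a) = iota a,
      forall a b, D a -> D b -> s (a - b) = s a - s b
    & forall a b, D a -> D b -> s (a * b) = s a * s b].

Lemma adjoin_subfield (A : set L) : is_subfield (adjoin iota A).
Proof. exact: subfield_gen_subfield. Qed.

Lemma adjoin_iota (A : set L) a : adjoin iota A (iota a).
Proof. by apply: sub_gen_smallest; left; exists a. Qed.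

Lemma sub_adjoin (A : set L) : A `<=` adjoin iota A.
Proof. by move=> a Aa; apply: sub_gen_smallest; right. Qed.

Lemma adjoin_min (A M : set L) : is_subfield M -> range iota `<=` M ->
  A `<=` M -> adjoin iota A `<=` M.
Proof. by move=> sM sFM sAM; apply: smallest_sub => // a [/sFM|/sAM]. Qed.

(** Take a primitive element [z] of the finitely generated field and write
    y = h(z). A conjugate [z'] of [z] with h(z') = y' satisfies the same
    polynomial relations over the base field as [z], so that sending k(z) to
    k(z') is well defined and multiplicative. *)
Lemma embedding_extension (l : seq L) q y y' :
    adjoin iota [set` l] y -> irreducible_poly q ->
    root q^f y -> root q^f y' ->
  exists2 s, embeds_on (adjoin iota [set` l]) s & s y = y'.
Proof.
move=> ly irr_q qy qy'; have [z Dz] := primitive_element l.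
have sub_lz : adjoin iota [set` l] `<=` poly_values z.
  apply: adjoin_min => [|_ [a _ <-]|w /Dz//]; first exact: poly_values_subfield.
  exact: poly_values_iota.
have [h Dy] := sub_lz y ly; rewrite -Dy in qy.
have [z' zz' Dy'] := conjugate_lift irr_q qy qy'.
have /choice[hh Dhh] : forall w, exists k, poly_values z w -> k^f.[z] = w.
  by move=> w; case: (pselect (poly_values z w)) => [[k Dk]|nw];
    [exists k|exists 0].
pose s w := (hh w)^f.[z'].
have sE w k : k^f.[z] = w -> s w = k^f.[z'].
  move=> Dk; have: root (hh w - k)^f z.
    by rewrite rootE rmorphB !hornerE (Dhh w) ?Dk ?subrr //; exists k.
  by rewrite zz' rootE rmorphB !hornerE subr_eq0 => /eqP.
exists s; last by rewrite (sE y h).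
split=> [a|a b /sub_lz[h1 D1] /sub_lz[h2 D2]|a b /sub_lz[h1 D1] /sub_lz[h2 D2]].
- by rewrite (sE _ a%:P) map_polyC hornerC.
- by rewrite (sE a h1) // (sE b h2) // (sE _ (h1 - h2)) rmorphB !hornerE ?D1 ?D2.
- by rewrite (sE a h1) // (sE b h2) // (sE _ (h1 * h2)) rmorphM !hornerE ?D1 ?D2.
Qed.

End Conjugation.

(** Modulo the quadratic equation, which is also satisfied by the second root
    [al - s], the k-th power of a root is [A * s + B] with [A] and [B] in [M]
    common to both roots. If [A] is non-zero, this expresses [s] in [M];
    otherwise both k-th powers are equal to [B]. *)
Lemma quadratic_power (L : fieldType) (M : set L) (al ga s : L) k :
    is_subfield M -> M al -> M ga -> s ^+ 2 = al * s + ga -> M (s ^+ k) ->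
  M s \/ (al - s) ^+ k = s ^+ k.
Proof.
move=> sM Mal Mga quad Msk.
have [A [B [MA MB Dpow]]] : exists A B, [/\ M A, M B &
    forall x, x ^+ 2 = al * x + ga -> x ^+ k = A * x + B].
  elim: k {Msk} => [|k [A [B [MA MB IHk]]]].
    exists 0, 1; split=> [||x _]; [exact: subfield0|exact: subfield1|].
    by rewrite mul0r add0r.
  exists (A * al + B), (A * ga); split=> [||x Dx].
  - by apply: (subfieldD sM) => //; apply: subfieldM.
  - exact: subfieldM.
  - by rewrite exprSr IHk // mulrDl -mulrA -expr2 Dx; ring.
have [A0|nzA] := eqVneq A 0; [right|left].
  by rewrite !Dpow // ?A0 ?mul0r // sqrrB quad; ring.
have -> : s = (s ^+ k - B) / A by rewrite Dpow // addrK mulrC mulKf.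
by apply: (subfield_div sM) => //; apply: subfieldB.
Qed.

(** * The additive polynomial of the tower and the function g *)
Section ArtinSchreier.
Variables (p : nat) (L : fieldType).
Implicit Types (a b c s t v w : L).

Definition wp w : L := w ^+ p + w.

(** Once [L] contains the field with p^2 elements, this says that [w] lies
    outside of it. *)
Definition nonconst w := w ^+ p ^+ p != w.

Lemma root_step t s : root (step_poly p t) s = (wp s == g p t).
Proof. by rewrite rootE /step_poly !hornerE subr_eq0. Qed.

Hypothesis charL : p \in [pchar L].

Let p_prime : prime p. Proof. exact: pcharf_prime charL. Qed.
Let p_gt0 : (0 < p)%N. Proof. exact: prime_gt0. Qed.

Lemma pchar_pnat_exp k : [pchar L].-nat (p ^ k)%N.
Proof. by rewrite pnatX pnatE // charL. Qed.

Lemma frobeniusD a b : (a + b) ^+ p = a ^+ p + b ^+ p.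
Proof. by rewrite exprDn_pchar // -[p]expn1 pchar_pnat_exp. Qed.

Lemma frobeniusN a : (- a) ^+ p = - a ^+ p.
Proof. by rewrite exprNn_pchar // -[p]expn1 pchar_pnat_exp. Qed.

Lemma wpD a b : wp (a + b) = wp a + wp b.
Proof. by rewrite /wp frobeniusD; ring. Qed.

Lemma wpN a : wp (- a) = - wp a.
Proof. by rewrite /wp frobeniusN; ring. Qed.

Lemma nonconst_wp w : nonconst w -> wp w != 0.
Proof.
apply: contraNneq => /eqP; rewrite addr_eq0 => /eqP Dw.
by rewrite Dw frobeniusN Dw opprK.
Qed.

Lemma nonconst_neq0 w : nonconst w -> w != 0.
Proof. by apply: contraNneq => ->; rewrite !expr0n gtn_eqF //= expr0n gtn_eqF. Qed.

Lemma nonconstD w a : a ^+ p = - a -> nonconst w -> nonconst (w + a).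
Proof. by move=> Da; rewrite /nonconst !(frobeniusD, Da, frobeniusN) opprK (inj_eq (addIr a)). Qed.

(** This makes 1 / P(s) = P(1/w) whenever s is a solution of P(s) = g(w). *)
Lemma wpV w : w != 0 -> wp w^-1 = (g p w)^-1.
Proof.
move=> nzw; rewrite /wp /g invf_div exprVn exprS invfM.
have nzwp: w ^+ p != 0 by rewrite expf_neq0.
by field; rewrite nzw nzwp.
Qed.

(** If [s] lies in the field with p^2 elements, then P(s) = g(w) is
    fixed by the Frobenius, and so is its inverse P(1/w); but P(1/w) is fixed
    by the Frobenius only if 1/w lies in the field with p^2 elements. *)
Lemma nonconst_step w s : nonconst w -> wp s = g p w -> nonconst s.
Proof.
move=> ncw Ds; apply: contraNneq (ncw) => fixs.
have nzw := nonconst_neq0 ncw.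
have fixg : g p w ^+ p = g p w by rewrite -Ds /wp frobeniusD fixs addrC.
have : wp w^-1 ^+ p = wp w^-1 by rewrite wpV // exprVn fixg.
by rewrite /wp frobeniusD addrC => /addrI; rewrite !exprVn => /invr_inj->.
Qed.

Lemma g_shift w c : c ^+ p = - c -> wp w != 0 ->
  g p (w + c) = g p w + c - (2%:R * c * w + c ^+ 2) / wp w.
Proof.
move=> Dc nzw; rewrite /g -!/(wp _) wpD {2}/wp Dc addNr addr0.
rewrite !exprSr frobeniusD Dc.
have -> : w ^+ p = wp w - w by rewrite /wp addrK.
by field.
Qed.

Hypothesis p_odd : odd p.

Lemma two_neq0 : 2%:R != 0 :> L.
Proof.
rewrite -(dvdn_pcharf charL); apply: contraL p_odd => /(dvdn_leq (isT : (0 < 2)%N)).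
by case: (p) p_prime => [|[|[|]]].
Qed.

Lemma exp2p : 2%:R ^+ p = 2%:R :> L.
Proof. by rewrite -[2%:R]/(1 + 1) frobeniusD expr1n. Qed.

(** Put c = b/2, s = t + c, tau = s / P(s) and e = s^(p-1), so that
    1/tau = e + 1. The difference of g(s + c) and g(s - c) is 2c - 4c tau,
    which puts tau and e into [M]; their half sum is s e tau - c^2 tau / s,
    which makes [s] a root of a quadratic polynomial over [M] with product of
    roots - c^2 / e. By [quadratic_power], either [s] is in [M] or the second
    root has the same power e. In the latter case the (p-1)-st power of the
    product gives e^2 = e^(1-p), as c^(p-1) = -1 and p - 1 is even; then
    s^(p^2-1) = e^(p+1) = 1 and [s] is constant. *)
Lemma g_step_descent (M : set L) b t :
    is_subfield M -> M b -> b ^+ p = - b -> b != 0 -> nonconst t ->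
    M (g p t) -> M (g p (t + b)) -> M t.
Proof.
move=> sM Mb Db nzb nct Mgt Mgtb.
have M2 : M 2%:R by apply: (subfieldD sM (a := 1) (b := 1)); apply: subfield1.
have nz2 := two_neq0.
pose c := b / 2%:R; pose s := t + c; pose tau := s / wp s.
have Mc : M c by apply: subfield_div.
have Dc : c ^+ p = - c by rewrite /c expr_div_n exp2p Db mulNr.
have nzc : c != 0 by rewrite mulf_neq0 ?invr_eq0.
have ncs : nonconst s by apply: nonconstD.
have nzs := nonconst_neq0 ncs; have nzP := nonconst_wp ncs.
have Dt : t = s - c by rewrite /s addrK.
have Dtb : t + b = s + c by rewrite /s /c; field.
have gt : g p t = g p s - c + (2%:R * c * s - c ^+ 2) / wp s.
  by rewrite Dt g_shift ?frobeniusN ?Dc ?opprK //; ring.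
have gtb : g p (t + b) = g p s + c - (2%:R * c * s + c ^+ 2) / wp s.
  by rewrite Dtb g_shift.
have nztau : tau != 0 by rewrite mulf_neq0 ?invr_eq0.
have Mtau : M tau.
  have -> : tau = (g p t - g p (t + b) + 2%:R * c) / (4%:R * c).
    by rewrite gt gtb /tau; field; rewrite nzP nzc -[4%:R]/((2 * 2)%:R) natrM mulf_neq0.
  have M4 : M 4%:R by rewrite -[4%:R]/((2 * 2)%:R) natrM; apply: subfieldM.
  apply: subfield_div (subfieldM sM M4 Mc) => //.
  by apply: subfieldD (subfieldB sM Mgt Mgtb) (subfieldM sM M2 Mc).
pose e := s ^+ p.-1.
have Dsp : s ^+ p = s * e by rewrite -exprS prednK.
have De : e = tau^-1 - 1.
  by rewrite /tau invf_div /wp Dsp; field.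
have Me : M e by rewrite De; apply: subfieldB (subfieldV sM Mtau) (subfield1 sM).
have nze : e != 0 by rewrite expf_neq0.
pose A0 := (g p t + g p (t + b)) / 2%:R.
have MA0 : M A0 by exact (subfield_div sM (subfieldD sM Mgt Mgtb) M2).
have DA0 : A0 = s * e * tau - c ^+ 2 * tau / s.
  rewrite /A0 gt gtb /g -/(wp s) exprSr Dsp /tau.
  by field; rewrite nzP nzs.
pose al := A0 / (tau * e); pose ga := c ^+ 2 / e.
have Mal : M al by exact (subfield_div sM MA0 (subfieldM sM Mtau Me)).
have Mga : M ga by exact (subfield_div sM (subfieldX sM 2 Mc) Me).
have quad : s ^+ 2 = al * s + ga.
  by rewrite /al /ga DA0; field; rewrite nztau nze nzs.
have [Ms|] := quadratic_power sM Mal Mga quad Me.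
  by rewrite Dt; apply: subfieldB.
rewrite -/e => eqe.
have Dga : s * (al - s) = - ga by rewrite mulrBr -expr2 quad; ring.
have even_p1 : odd p.-1 = false by move: p_odd; rewrite -{1}(prednK p_gt0) /=; case: odd.
have Dc1 : c ^+ p.-1 = -1.
  by apply: (mulfI nzc); rewrite -exprS prednK // Dc mulrN1.
have : e ^+ p.+1 = 1.
  have /(congr1 (fun a => a ^+ p.-1)) := Dga.
  rewrite exprMn eqe -/e exprNn -signr_odd even_p1 mul1r /ga expr_div_n.
  rewrite exprAC Dc1 sqrrN expr1n => ee.
  have -> : p.+1 = (2 + p.-1)%N by rewrite add2n prednK.
  by rewrite exprD expr2 ee mul1r mulVf ?expf_neq0.
rewrite /e -exprM => e1; case/eqP: ncs.
rewrite -exprM -[RHS]mulr1 -e1 -exprS; congr (_ ^+ _).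
by case: (p) p_gt0 => // k _ /=; rewrite !mulSn !mulnS; ring.
Qed.

End ArtinSchreier.

(** * Constants and the fibres of the additive polynomial *)
Section Constants.
Variables (p : nat) (K : finFieldType) (cardK : #|K| = (p ^ 2)%N).
Variables (L : fieldType) (charL : p \in [pchar L]) (j : {rmorphism K -> L}).
Implicit Types (s t v w : L) (xi : K).

Lemma fixed_const w : w ^+ p ^+ p = w -> exists a : K, w = j a.
Proof.
move=> fixw; have : root (map_poly j ('X^#|K| - 'X)) w.
  by rewrite rmorphB /= map_polyXn map_polyX rootE !hornerE cardK
    -mulnn exprM fixw subrr.
rewrite finField_genPoly rmorph_prod /= -big_enum /=.
under eq_bigr => x _ do rewrite map_polyXsubC.
rewrite -(big_map j predT (fun r => 'X - r%:P)) root_prod_XsubC.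
by case/mapP=> a _ ->; exists a.
Qed.

Lemma Kminus_exp xi : xi \in Kminus p K -> j xi ^+ p = - j xi.
Proof. by move/eqP=> Dxi; rewrite -rmorphXn Dxi rmorphN. Qed.

Lemma wp_eq0 w : wp p w = 0 -> exists2 xi, xi \in Kminus p K & w = j xi.
Proof.
move/eqP; rewrite /wp addr_eq0 => /eqP Dw.
have [|xi Dxi] := @fixed_const w; first by rewrite Dw (frobeniusN charL) Dw opprK.
exists xi => //; rewrite inE -(inj_eq (fmorph_inj j)) rmorphXn rmorphN -Dxi.
by rewrite Dw.
Qed.

Lemma wp_fiber v s : wp p v = wp p s -> exists2 xi, xi \in Kminus p K & v = s + j xi.
Proof.
move=> eqw; have [|xi Kxi Dxi] := @wp_eq0 (v - s).
  by rewrite (wpD charL) (wpN charL) eqw subrr.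
by exists xi; rewrite // -Dxi addrC subrK.
Qed.

(** With k = xi/b in the prime field and 1 / P(t) = P(1/w), the shift formula
    for g shows that u0 + k (ub - u0) - k (k - 1) b^2 / w has the same image
    under P as [v]: the map P commutes with factors in the prime field, and b^2
    is one of them since b^p = -b. *)
Lemma g_step_span (M : set L) b t w u0 ub v xi :
    is_subfield M -> range j `<=` M -> M b -> b ^+ p = - b -> b != 0 ->
    nonconst p w -> wp p t = g p w -> M w ->
    M u0 -> wp p u0 = g p t -> M ub -> wp p ub = g p (t + b) ->
  xi \in Kminus p K -> wp p v = g p (t + j xi) -> M v.
Proof.
move=> sM sjM Mb Db nzb ncw Dt Mw Mu0 Du0 Mub Dub Kxi Dv.
have nzw := nonconst_neq0 charL ncw; have nct := nonconst_step charL ncw Dt.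
have nzP := nonconst_wp charL nct.
have Mj x : M (j x) by apply: sjM; exists x.
pose k := j xi / b.
have Dk : k ^+ p = k by rewrite /k expr_div_n Kminus_exp // Db invrN mulrNN.
have Mk : M k by apply: subfield_div.
have wpM a : wp p (k * a) = k * wp p a by rewrite /wp exprMn Dk mulrDr.
have Db2 : (b ^+ 2) ^+ p = b ^+ 2 by rewrite exprAC Db sqrrN.
have wpM2 a : wp p (b ^+ 2 * a) = b ^+ 2 * wp p a by rewrite /wp exprMn Db2 mulrDr.
pose s := u0 + k * (ub - u0) - k * ((k - 1) * (b ^+ 2 * w^-1)).
have wpM1 a : wp p ((k - 1) * a) = (k - 1) * wp p a.
  by rewrite mulrBl mul1r (wpD charL) (wpN charL) wpM; ring.
(* Two solutions of the same equation differ by a constant. *)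
have [|xi' _ ->] := @wp_fiber v s.
  rewrite Dv /s !(wpM, wpM1, wpM2, wpD charL, wpN charL) wpV // -Dt Dub Du0.
  have -> : j xi = k * b by rewrite /k mulfVK.
  rewrite !(g_shift charL) //; last by rewrite exprMn Dk Db mulrN.
  by field.
apply: (subfieldD sM) => //; apply: (subfieldB sM).
  by apply: subfieldD => //; apply: subfieldM => //; apply: subfieldB.
do 2!apply: (subfieldM sM) => //; first by apply: subfieldB; last exact: subfield1.
by apply: subfield_div => //; apply: subfieldX.
Qed.

End Constants.

(** * Total ramification of the tower at the pole of its first variable *)
Section TowerDegree.
Variables (p : nat) (K L : fieldType) (charL : p \in [pchar L]).
Variable j : {rmorphism K -> L}.
Variables (x : nat -> L).
Hypothesis x1_transcendental :
  forall h : {poly K}, h != 0 -> (map_poly j h).[x 1%N] != 0.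
Hypothesis x_step : forall i, (0 < i)%N -> wp p (x i.+1) = g p (x i).

Let p_prime : prime p. Proof. exact: pcharf_prime charL. Qed.
Let p_gt0 : (0 < p)%N. Proof. exact: prime_gt0. Qed.

Lemma x1_nonconst : nonconst p (x 1%N).
Proof.
have nz : 'X^(p * p) - 'X != 0 :> {poly K}.
  apply/eqP => /(congr1 (fun q : {poly K} => q`_1)); rewrite coefB coefXn coefX coef0 /=.
  have -> : (1 == p * p)%N = false.
    by apply/eqP => /esym/eqP; rewrite muln_eq1 andbb; case: (p) p_prime => [|[]].
  by rewrite sub0r => /eqP; rewrite oppr_eq0 oner_eq0.
have := x1_transcendental nz; rewrite rmorphB /= map_polyXn map_polyX !hornerE.
by rewrite subr_eq0 /nonconst -exprM.
Qed.

Lemma tower_nonconst i : (0 < i)%N -> nonconst p (x i).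
Proof.
case: i => // i _; elim: i => [|i IHi]; first exact: x1_nonconst.
exact: (nonconst_step charL IHi (x_step (ltn0Sn i))).
Qed.

Let y i := (x i)^-1.
Let ev : {rmorphism {poly K} -> L} := horner_eval (y 1%N) \o map_poly j.
Local Notation integral := (integralOver ev).

Lemma integral_const c : integral (j c).
Proof.
by have := integral_id ev c%:P; rewrite /= map_polyC /horner_eval hornerC.
Qed.

Lemma integralX k b : integral b -> integral (b ^+ k).
Proof.
move=> ib; elim: k => [|k IHk]; first exact: integral1.
by rewrite exprS; apply: integral_mul.
Qed.

Lemma integral_y1 : integral (y 1%N).
Proof.
by have := integral_id ev 'X; rewrite /= map_polyX /horner_eval hornerX.
Qed.

Lemma x_neq0 i : (0 < i)%N -> x i != 0.
Proof. by move/tower_nonconst/(nonconst_neq0 charL). Qed.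

Lemma y1_transcendental (h : {poly K}) : root (map_poly j h) (y 1%N) -> h = 0.
Proof.
move=> hy; apply/eqP/negPn/negP => nzh.
have /integral_algebraic/integral_inv : algebraicOver j (y 1%N) by exists h.
rewrite invrK => -[q mon_q]; rewrite rootE; apply/negP/x1_transcendental.
exact: monic_neq0.
Qed.

(** Multiplying a monic equation of degree n by y_1^n turns it into a
    polynomial relation for y_1 over [K] with constant term 1. *)
Lemma x1_not_integral : ~ integral (x 1%N).
Proof.
case=> q mon_q /rootP; rewrite horner_coef size_map_poly_id0; last first.
  by rewrite (monicP mon_q) rmorph1 oner_eq0.
have Dn : size q = (size q).-1.+1 by rewrite prednK // size_poly_gt0 monic_neq0.
have := monicP mon_q; rewrite lead_coefE; move: (size q).-1 Dn => n -> lcq.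
have evq i : (map_poly ev q)`_i = ev q`_i := coef_map ev q i.
rewrite big_ord_recr evq lcq (rmorph1 ev) mul1r => eq0.
pose h := \sum_(i < n) q`_i * 'X^(n - i) + 1.
have: h = 0.
  apply: y1_transcendental; rewrite rootE rmorphD rmorph1 rmorph_sum /= hornerD hornerC.
  apply/eqP; have /(congr1 (fun w => w * y 1%N ^+ n)) := eq0.
  rewrite mul0r => <-; rewrite mulrDl -exprMn mulfV ?x_neq0 // expr1n; congr (_ + 1).
  rewrite horner_sum mulr_suml; apply: eq_bigr => i _.
  rewrite rmorphM /= map_polyXn hornerM hornerXn evq -mulrA; congr (_ * _).
  have -> : y 1%N ^+ n = y 1%N ^+ i * y 1%N ^+ (n - i).
    by rewrite -exprD subnKC // ltnW.
  by rewrite mulrA -exprMn mulfV ?x_neq0 // expr1n mul1r.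
move=> /(congr1 (fun k : {poly K} => k`_0)); rewrite /h coefD coef_sum big1 => [|i _].
  by rewrite add0r coef1 coef0 => /eqP; rewrite oner_eq0.
by rewrite coefMXn subn_gt0 ltn_ord.
Qed.

(** The radical of the ideal generated by y_1 in the integral closure of
    K[y_1]: all of its elements vanish at every place above the pole of x_1.
    Exponents are restricted to powers of p, so that stability under addition is
    immediate from the Frobenius. *)
Definition at_place w := integral w /\ exists k, integral (x 1%N * w ^+ (p ^ k)).

Lemma at_place_mono w k l : integral w -> (k <= l)%N ->
  integral (x 1%N * w ^+ (p ^ k)) -> integral (x 1%N * w ^+ (p ^ l)).
Proof.
move=> iw lekl ik; have lepkl : (p ^ k <= p ^ l)%N by rewrite leq_pexp2l.
rewrite -(subnKC lepkl) exprD mulrA.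
by apply: integral_mul => //; apply: integralX.
Qed.

Lemma at_placeD v w : at_place v -> at_place w -> at_place (v + w).
Proof.
move=> [iv [k ik]] [iw [l il]]; split; first exact: integral_add.
exists (maxn k l); rewrite exprDn_pchar ?(pchar_pnat_exp charL) // mulrDr.
apply: integral_add; [apply: at_place_mono ik|apply: at_place_mono il] => //.
  exact: leq_maxl.
exact: leq_maxr.
Qed.

Lemma at_placeM b w : integral b -> at_place w -> at_place (b * w).
Proof.
move=> ib [iw [k ik]]; split; first exact: integral_mul.
by exists k; rewrite exprMn mulrCA; apply: integral_mul => //; apply: integralX.
Qed.

Lemma integralN1 : integral (-1).
Proof. by apply: integral_opp; apply: integral1. Qed.

Lemma at_placeB v w : at_place v -> at_place w -> at_place (v - w).
Proof.
move=> Jv Jw; apply: at_placeD => //; rewrite -mulN1r; apply: at_placeM => //.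
exact: integralN1.
Qed.

Lemma at_place0 : at_place 0.
Proof.
split; first exact: integral0.
by exists 0%N; rewrite expn0 expr1 mulr0; apply: integral0.
Qed.

Lemma at_place_root k w : integral w -> at_place (w ^+ (p ^ k)) -> at_place w.
Proof.
move=> iw [_ [l il]]; split=> //; exists (k + l)%N.
by rewrite expnD exprM.
Qed.

Lemma at_placeX k w : (0 < k)%N -> at_place w -> at_place (w ^+ k).
Proof.
case: k => // k _ Jw; rewrite exprSr; apply: at_placeM => //.
by apply: integralX; case: Jw.
Qed.

Lemma one_not_at_place : ~ at_place 1.
Proof. by case=> _ [k]; rewrite expr1n mulr1; apply: x1_not_integral. Qed.

Let e i := 1 + y i ^+ p.-1.

(** The equation P(x_(i+1)) = g(x_i) in terms of inverses, where it reads
    P(y_i) = 1 / P(x_(i+1)). *)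
Lemma y_step i : (0 < i)%N -> y i.+1 ^+ p = e i.+1 * (e i * y i).
Proof.
move=> i_gt0; have nzS := x_neq0 (ltn0Sn i); have nzi := x_neq0 i_gt0.
have nzw := nonconst_wp charL (tower_nonconst (ltn0Sn i)).
have -> : e i * y i = (wp p (x i.+1))^-1.
  rewrite x_step // -wpV // /wp /e mulrDl mul1r -exprSr prednK //; exact: addrC.
apply: (mulIf nzw); rewrite -mulrA mulVf // mulr1 /wp mulrDr /e /y.
rewrite -exprMn mulVf // expr1n; congr (_ + _).
by rewrite -{1}(prednK p_gt0) exprSr -mulrA mulVf ?mulr1.
Qed.

Lemma e_integral i : integral (y i) -> integral (e i).
Proof. by move=> iy; apply: integral_add; [apply: integral1|apply: integralX]. Qed.

(** Expanding e_(i+1) = 1 + y_(i+1)^(p-1) in [y_step] gives a monic equation of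
    degree p for y_(i+1). *)
Lemma y_integral_step i : (0 < i)%N -> integral (y i) -> integral (y i.+1).
Proof.
move=> i_gt0 iy; set a := e i * y i.
have ia : integral a by apply: integral_mul => //; apply: e_integral.
have p1_lt : (p.-1 < p)%N by rewrite ltn_predL.
pose r := a *: 'X^(p.-1) + a%:P; pose q := 'X^p - r.
have szr : (size r < size ('X^p : {poly L}))%N.
  rewrite size_polyXn ltnS (leq_trans (size_polyD _ _)) // geq_max.
  rewrite (leq_trans (size_scale_leq _ _)) ?size_polyXn ?prednK //.
  by rewrite (leq_trans (size_polyC_leq1 _)).
have mon_q : q \is monic.
  by rewrite monicE lead_coefDl ?size_polyN // lead_coefXn.
apply: (integral_root_monic mon_q) => [|c].
  by rewrite rootE !hornerE (y_step i_gt0) -/a /e; apply/eqP; ring.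
case/(nthP 0) => k _ <-; rewrite coefB coefXn coefD coefZ coefXn coefC.
apply: integral_sub; first exact: integral_nat.
apply: integral_add; first by apply: integral_mul => //; apply: integral_nat.
by case: ifP => _ //; apply: integral0.
Qed.

Lemma y_at_place i : (0 < i)%N -> at_place (y i).
Proof.
case: i => // i _; elim: i => [|i IHi].
  split; first exact: integral_y1.
  exists 0%N; rewrite expn0 expr1 mulfV ?x_neq0 //; exact: integral1.
have iyS : integral (y i.+2) by apply: y_integral_step => //; case: IHi.
apply: (at_place_root (k := 1)) => //.
rewrite expn1 y_step //; apply: at_placeM; first exact: e_integral.
by apply: at_placeM => //; apply: e_integral; case: IHi.
Qed.

Lemma y_integral i : (0 < i)%N -> integral (y i).
Proof. by case/y_at_place. Qed.

(** Integral elements with value 1 at every place above the pole of x_1. *)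
Definition principal_unit w := at_place (w - 1).

Lemma principal_unit_integral w : principal_unit w -> integral w.
Proof.
by case=> iw _; rewrite -[w](subrK 1); apply: integral_add => //; apply: integral1.
Qed.

Lemma principal_unitM v w :
  principal_unit v -> principal_unit w -> principal_unit (v * w).
Proof.
move=> uv uw; rewrite /principal_unit.
have -> : v * w - 1 = w * (v - 1) + (w - 1) by ring.
by apply: at_placeD => //; apply: at_placeM => //; apply: principal_unit_integral.
Qed.

Lemma principal_unitX k w : principal_unit w -> principal_unit (w ^+ k).
Proof.
move=> uw; elim: k => [|k IHk]; last by rewrite exprS; apply: principal_unitM.
by rewrite /principal_unit subrr; apply: at_place0.
Qed.

Lemma e_principal i : (0 < i)%N -> principal_unit (e i).
Proof.
move=> i_gt0; rewrite /principal_unit /e addrC addKr; apply: at_placeX.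
  by rewrite -ltnS prednK // prime_gt1.
exact: y_at_place.
Qed.

Lemma total_ramification m :
  exists2 E, principal_unit E & E * y 1%N = y m.+1 ^+ (p ^ m).
Proof.
elim: m => [|m [E uE DE]].
  exists 1; last by rewrite mul1r expn0 expr1.
  by rewrite /principal_unit subrr; apply: at_place0.
exists ((e m.+2 * e m.+1) ^+ (p ^ m) * E).
  apply: principal_unitM => //; apply: principal_unitX.
  by apply: principal_unitM; apply: e_principal.
by rewrite -mulrA DE -exprMn -mulrA -y_step // -exprM -expnS.
Qed.

Lemma at_place_monomial i k m : (0 < m)%N -> (i < k)%N ->
  at_place (y m ^+ k * x m ^+ i).
Proof.
move=> m_gt0 ltik; rewrite -(subnK (ltnW ltik)) exprD -mulrA -exprMn mulVf ?x_neq0 //.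
rewrite expr1n mulr1; apply: at_placeX; first by rewrite subn_gt0.
exact: y_at_place.
Qed.

Lemma at_place_sum k (f : nat -> L) :
  (forall i, (i < k)%N -> at_place (f i)) -> at_place (\sum_(i < k) f i).
Proof.
move=> Jf; apply: (big_ind at_place) => [|v w|i _]; [exact: at_place0|exact: at_placeD|].
exact: Jf.
Qed.

(** In terms of y = 1/x, the left factor turns the polynomial in x into one in
    y all of whose exponents are positive. *)
Lemma at_place_small_poly k m (h : {poly K}) : (0 < m)%N -> (size h <= k)%N ->
  at_place (y m ^+ k * (map_poly j h).[x m]).
Proof.
move=> m_gt0 szh; rewrite horner_coef size_map_poly mulr_sumr.
apply: (at_place_sum (f := fun i => y m ^+ k * ((map_poly j h)`_i * x m ^+ i))) => i lti.
rewrite mulrCA coef_map; apply: at_placeM; first exact: integral_const.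
by apply: at_place_monomial => //; apply: leq_trans szh.
Qed.

(** Only the leading monomial survives as a monomial of exponent 0 in y. *)
Lemma at_place_lead m (h : {poly K}) : (0 < m)%N -> h != 0 ->
  at_place (y m ^+ (size h).-1 * (map_poly j h).[x m] - j (lead_coef h)).
Proof.
move=> m_gt0 nzh; rewrite horner_coef size_map_poly lead_coefE.
have -> : size h = (size h).-1.+1 by rewrite prednK // size_poly_gt0.
move: (size h).-1 => d /=; rewrite big_ord_recr /= coef_map mulrDr.
have -> : y m ^+ d * (j h`_d * x m ^+ d) = j h`_d.
  by rewrite mulrCA -exprMn mulVf ?x_neq0 // expr1n mulr1.
rewrite addrK mulr_sumr.
apply: (at_place_sum (f := fun i => y m ^+ d * ((map_poly j h)`_i * x m ^+ i))) => i lti.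
rewrite mulrCA coef_map; apply: at_placeM; first exact: integral_const.
exact: at_place_monomial.
Qed.

(** Suppose that the value is zero and sort the relation by powers of x_1. Its
    leading coefficient C is a non-zero polynomial in x_(m+1). After
    multiplication by y_1^D and by y_(m+1)^(deg C), the leading term tends to
    the leading coefficient of C at the place at infinity, while every other
    term has a factor y_1 y_(m+1)^(deg C). A principal unit turns this y_1 into
    y_(m+1)^(p^m), which absorbs the powers of x_(m+1), all of exponent below
    p^m. So a non-zero constant would vanish at the place. *)
Lemma tower_relation_degree m (q : {poly {poly K}}) :
    q != 0 -> (size q <= p ^ m)%N ->
  (map_poly (map_poly j) q).[(x m.+1)%:P].[x 1%N] != 0.
Proof.
move=> nzq szq; apply/eqP; rewrite -horner2_swapXY swapXY_map.
pose Q := swapXY q; rewrite -/Q.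
have nzQ : Q != 0 by rewrite swapXY_eq0.
have szQ k : (size (Q`_k)%R <= p ^ m)%N.
  apply/leq_sizeP => i lei.
  by rewrite coef_swapXY (nth_default _ (leq_trans szq lei)) coef0.
have [E uE DE] := total_ramification m; set t := m.+1.
rewrite [(map_poly _ Q).[_]]horner_coef size_map_inj_poly ?rmorph0 //; last first.
  exact: map_poly_inj.
set X1 := x 1%N; set Y1 := y 1%N.
have Y1X1 : Y1 * X1 = 1 by rewrite mulVf ?x_neq0.
rewrite horner_sum.
under eq_bigr => k _ do rewrite coef_map -polyC_exp hornerM hornerC.
have lcQ : Q`_(size Q).-1 = lead_coef Q by [].
have -> : size Q = (size Q).-1.+1 by rewrite prednK // size_poly_gt0.
move: (size Q).-1 lcQ => D lcQ; rewrite big_ord_recr /= lcQ.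
set C := lead_coef Q; have nzC : C != 0 by rewrite lead_coef_eq0.
set Cx := (map_poly j C).[x t].
move/(congr1 (fun w => E * y t ^+ (size C).-1 * (w * Y1 ^+ D))).
rewrite mul0r mulr0 mulrDl -[Cx * _ * _]mulrA -exprMn [X1 * Y1]mulrC Y1X1 expr1n mulr1.
rewrite mulrDr => /eqP; rewrite addrC addr_eq0 => /eqP DCx.
have iE := principal_unit_integral uE.
have JCx : at_place (E * (y t ^+ (size C).-1 * Cx)).
  rewrite mulrA DCx -mulN1r; apply: at_placeM; first exact: integralN1.
  rewrite !mulr_suml mulr_sumr.
  pose f k := E * y t ^+ (size C).-1 * ((map_poly j Q`_k).[x t] * X1 ^+ k * Y1 ^+ D).
  apply: (at_place_sum (f := f)) => k ltk; rewrite /f.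
  (* One factor y_1 is kept apart, to be traded for y_(m+1)^(p^m) by DE. *)
  have -> : Y1 ^+ D = Y1 ^+ k * (Y1 * Y1 ^+ (D - k.+1)).
    by rewrite -exprS -exprD -subSn // subSS subnKC // ltnW.
  have -> : E * y t ^+ (size C).-1 * ((map_poly j Q`_k).[x t] * X1 ^+ k
             * (Y1 ^+ k * (Y1 * Y1 ^+ (D - k.+1))))
    = (Y1 * X1) ^+ k * (Y1 ^+ (D - k.+1) * y t ^+ (size C).-1)
      * (y t ^+ (p ^ m) * (map_poly j Q`_k).[x t]).
    rewrite -[y t ^+ (p ^ m)]DE -/Y1.
    move: (y t ^+ _) (Y1 ^+ (D - _)) (_.[x t]) => Z W H; rewrite exprMn.
    by clearbody X1 Y1; ring.
  rewrite Y1X1 expr1n mul1r; apply: at_placeM.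
    by apply: integral_mul; apply: integralX; apply: y_integral.
  exact: at_place_small_poly.
have JC : at_place (j (lead_coef C)).
  set lc := j _.
  have -> : lc = E * (y t ^+ (size C).-1 * Cx)
                 - (E * (y t ^+ (size C).-1 * Cx - lc) + lc * (E - 1)).
    by move: (y t ^+ _ * Cx) => W; clearbody lc; ring.
  apply: at_placeB => //; apply: at_placeD; apply: at_placeM => //.
    exact: at_place_lead.
  exact: integral_const.
apply: one_not_at_place.
have -> : 1 = j (lead_coef C)^-1 * j (lead_coef C).
  by rewrite -rmorphM mulVf ?rmorph1 // lead_coef_eq0.
by apply: at_placeM => //; apply: integral_const.
Qed.

End TowerDegree.

Lemma fraction_num_den (R : idomainType) (c : {fraction R}) :
  exists2 d : R, d != 0 & exists n : R, tofrac d * c = tofrac n.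
Proof.
elim/quotW: c => r; exists \d_r; first exact: denom_ratioP.
exists \n_r; unlock FracField.tofrac; rewrite -[LHS]FracField.pi_mul.
apply/eqmodP; rewrite /= FracField.equivfE /FracField.mulf.
by rewrite !numden_Ratio ?mul1r ?mulr1 ?oner_neq0 ?denom_ratioP // mulrC.
Qed.

Lemma clear_denominators (R : idomainType) (q : {poly {fraction R}}) :
  exists2 d : R, d != 0 & exists r : {poly R}, tofrac d *: q = map_poly (@tofrac R) r.
Proof.
elim/poly_ind: q => [|q c [d nzd [r Dr]]].
  by exists 1; [exact: oner_neq0|exists 0; rewrite scaler0 rmorph0].
have [b nzb [n Dn]] := fraction_num_den c.
exists (b * d); first by rewrite mulf_neq0.
exists (b%:P * r * 'X + (d * n)%:P).
rewrite rmorphD !rmorphM /= map_polyX !map_polyC /= -Dr -Dn scalerDr -!mul_polyC !polyCM.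
by move: (tofrac b)%:P (tofrac d)%:P c%:P => B D C; ring.
Qed.

(** * Embeddings preserve the equations of the tower *)
Section EmbeddingTheory.
Variables (F L : fieldType) (iota : {rmorphism F -> L}) (D : set L) (s : L -> L).
Hypotheses (sD : is_subfield D).
Hypothesis emb : embeds_on iota D s.

Lemma embeds_iota a : s (iota a) = iota a. Proof. by case: emb. Qed.

Lemma embedsB a b : D a -> D b -> s (a - b) = s a - s b.
Proof. by case: emb => _ + _; apply. Qed.

Lemma embedsM a b : D a -> D b -> s (a * b) = s a * s b.
Proof. by case: emb => _ _; apply. Qed.

Lemma embeds0 : s 0 = 0.
Proof. by rewrite -(rmorph0 iota) embeds_iota. Qed.

Lemma embeds1 : s 1 = 1.
Proof. by rewrite -(rmorph1 iota) embeds_iota. Qed.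

Lemma embedsD a b : D a -> D b -> s (a + b) = s a + s b.
Proof.
move=> Da Db; have DN : D (- b) by apply: subfieldN.
rewrite -{1}[b]opprK embedsB // -[- b]sub0r embedsB ?embeds0 ?sub0r ?opprK //.
exact: subfield0.
Qed.

Lemma embedsX a k : D a -> s (a ^+ k) = s a ^+ k.
Proof.
move=> Da; elim: k => [|k IHk]; first by rewrite !expr0 embeds1.
by rewrite !exprS embedsM ?IHk //; apply: subfieldX.
Qed.

Lemma embedsV a : D a -> s a^-1 = (s a)^-1.
Proof.
move=> Da; have [->|nza] := eqVneq a 0; first by rewrite invr0 embeds0 invr0.
have sVa : s a^-1 * s a = 1.
  by rewrite -embedsM ?mulVf ?embeds1 //; apply: subfieldV.
have nzsa : s a != 0 by apply: contra_eq_neq sVa => ->; rewrite mulr0 eq_sym oner_eq0.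
by apply: (mulIf nzsa); rewrite sVa mulVf.
Qed.

Lemma embeds_preimage_subfield (M : set L) : is_subfield M ->
  is_subfield [set w | D w /\ M (s w)].
Proof.
move=> sM; apply: is_subfieldP => [|a b [Da Ma] [Db Mb]|a b [Da Ma] [Db Mb]|a [Da Ma]].
- by split; rewrite ?embeds1; apply: subfield1.
- by split; rewrite ?embedsB //; apply: subfieldB.
- by split; rewrite ?embedsM //; apply: subfieldM.
- by split; rewrite ?embedsV //; apply: subfieldV.
Qed.

Lemma embeds_step p t w : D t -> D w -> wp p t = g p w -> wp p (s t) = g p (s w).
Proof.
move=> Dt Dw Dtw; have DX a k : D a -> D (a ^+ k) by move=> *; apply: subfieldX.
have DP : D (w ^+ p + w) by apply: subfieldD => //; apply: DX.
have -> : wp p (s t) = s (wp p t) by rewrite /wp embedsD ?embedsX //; apply: DX.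
rewrite Dtw /g embedsM ?embedsV ?embedsD ?embedsX //; [exact: DX|exact: DX|].
exact: subfieldV.
Qed.

End EmbeddingTheory.

(** * The conjugates of the elements of the tower *)
Section Tower.
Variables (p : nat) (p_prime : prime p) (p_odd : odd p).
Variables (K : finFieldType) (cardK : #|K| = (p ^ 2)%N).
Variables (Omega : fieldType) (iota : {rmorphism ratfun K -> Omega}).
Variables (x : nat -> Omega) (x_tower : tower_seq p iota x).
Variables (u : seq K -> Omega) (u_fam : u_family p iota x u).

Let charO : p \in [pchar Omega].
Proof. by rewrite (fmorph_pchar (iota \o @tofrac {poly K} \o polyC)) (card_finPcharP cardK). Qed.

Let cst : {rmorphism K -> Omega} := iota \o @tofrac {poly K} \o polyC.

Lemma ratfun_infinite k : exists2 s : seq (ratfun K), uniq s & size s = k.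
Proof.
exists (mkseq (fun i => tofrac 'X^i) k); last exact: size_mkseq.
apply: mkseq_uniq => a b /eqP; rewrite tofrac_eq => /eqP /(congr1 (fun q : {poly K} => size q)).
by rewrite !size_polyXn => -[].
Qed.

(** Evaluating at x_1 is the embedding of K[X] through the rational function
    field, hence is injective. *)
Lemma horner_at_x1 (h : {poly K}) : (map_poly cst h).[x 1%N] = iota (tofrac h).
Proof.
case: x_tower => -> _; rewrite -[in RHS](comp_polyXr h) /comp_poly.
pose f : {rmorphism {poly K} -> Omega} := iota \o @tofrac {poly K}.
rewrite -[RHS]/(f _) -horner_map /=; congr (_.[_]).
by rewrite -map_poly_comp.
Qed.

Lemma tower_x1_transcendental (h : {poly K}) : h != 0 -> (map_poly cst h).[x 1%N] != 0.
Proof. by rewrite horner_at_x1 fmorph_eq0 tofrac_eq0. Qed.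

Lemma x_step i : (0 < i)%N -> wp p (x i.+1) = g p (x i).
Proof. by case: x_tower => _ /[apply]; rewrite root_step => /eqP. Qed.

Lemma tower_degree m (q : {poly ratfun K}) :
  q != 0 -> root (map_poly iota q) (x m.+1) -> (p ^ m < size q)%N.
Proof.
move=> nzq qx; rewrite ltnNge; apply/negP => szq.
have [d nzd [r Dr]] := clear_denominators q.
have nzd' : tofrac d != 0 by rewrite tofrac_eq0.
have szr : size r = size q.
  rewrite -(size_scale q nzd') Dr size_map_inj_poly ?rmorph0 // => a b /eqP.
  by rewrite tofrac_eq => /eqP.
have nzr : r != 0 by rewrite -size_poly_eq0 szr size_poly_eq0.
rewrite -szr in szq.
have := tower_relation_degree charO tower_x1_transcendental x_step nzr szq.
set R := map_poly _ r; rewrite -[X in X != 0]/(horner_eval (x 1%N) R.[_]).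
rewrite -horner_map [X in _.[X]]hornerC /R -map_poly_comp.
have -> : map_poly (horner_eval (x 1%N) \o map_poly cst) r
  = map_poly iota (map_poly (@tofrac _) r).
  by rewrite -map_poly_comp; apply: eq_map_poly => h; apply: horner_at_x1.
by rewrite -Dr map_polyZ hornerZ (rootP qx) mulr0 eqxx.
Qed.

(** Putting x_2 at the root makes the family a tree in which every edge is one
    and the same equation, [node_step]. *)
Definition node c : Omega := if c is [::] then x 2%N else u c.

Definition Kminus_seq (c : seq K) := {subset c <= Kminus p K}.

Lemma Kminus_rcons c xi : Kminus_seq c -> xi \in Kminus p K -> Kminus_seq (rcons c xi).
Proof. by move=> Kc Kxi a; rewrite mem_rcons inE => /orP[/eqP->|/Kc]. Qed.

Lemma Kminus_rconsP c xi : Kminus_seq (rcons c xi) -> Kminus_seq c /\ xi \in Kminus p K.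
Proof.
move=> Kcx; split=> [a ca|]; apply: Kcx; rewrite mem_rcons inE ?eqxx //.
by rewrite ca orbT.
Qed.

Lemma node_rcons c xi : node (rcons c xi) = u (rcons c xi).
Proof. by case: c. Qed.

Lemma node_nil : wp p (node [::]) = g p (x 1%N).
Proof. exact: x_step. Qed.

Lemma node_step c xi : Kminus_seq c -> xi \in Kminus p K ->
  wp p (node (rcons c xi)) = g p (node c + cst xi).
Proof.
case: u_fam => u1 uS Kc Kxi; apply/eqP; rewrite -root_step node_rcons.
case: c Kc => [|a c] Kc; first exact: u1.
exact: uS.
Qed.

(** All translates by K_- are included, so that level [k.+1] is the full set of
    solutions of P(s) = g(t) for t in level [k]: this is what makes levels
    stable under conjugation and independent of the chosen roots. *)
Definition level k : set Omega :=
  [set t | exists d, [/\ Kminus_seq d, size d = k &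
     exists2 xi, xi \in Kminus p K & t = node d + cst xi]].

Lemma Kminus0 : 0 \in Kminus p K.
Proof. by rewrite inE expr0n gtn_eqF ?prime_gt0 // oppr0. Qed.

Lemma KminusD xi zeta : xi \in Kminus p K -> zeta \in Kminus p K ->
  xi + zeta \in Kminus p K.
Proof.
rewrite !inE => /eqP Dxi /eqP Dzeta; rewrite opprD -Dxi -Dzeta.
by rewrite -(inj_eq (fmorph_inj cst)) rmorphXn !rmorphD !rmorphXn (frobeniusD charO).
Qed.

Lemma levelD k t xi : level k t -> xi \in Kminus p K -> level k (t + cst xi).
Proof.
move=> [d [Kd szd [zeta Kz ->]]] Kxi; exists d; split=> //.
exists (zeta + xi); first exact: KminusD.
by rewrite rmorphD addrA.
Qed.

Lemma level_node d : Kminus_seq d -> level (size d) (node d).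
Proof.
move=> Kd; exists d; split=> //; exists 0; first exact: Kminus0.
by rewrite rmorph0 addr0.
Qed.

Lemma level0 s : wp p s = g p (x 1%N) -> level 0 s.
Proof.
rewrite -node_nil => /(wp_fiber cardK charO cst)[xi Kxi ->].
by apply: levelD => //; apply: (@level_node [::]).
Qed.

Lemma levelS k t s : level k t -> wp p s = g p t -> level k.+1 s.
Proof.
move=> [d [Kd szd [zeta Kz ->]]]; rewrite -node_step //.
move/(wp_fiber cardK charO cst)=> [xi Kxi ->]; apply: levelD => //.
by rewrite -szd -(size_rcons d zeta); apply/level_node/Kminus_rcons.
Qed.

Lemma level_x k : level k (x k.+2).
Proof. by elim: k => [|k IHk]; [apply: level0|apply: (levelS IHk)]; apply: x_step. Qed.

Lemma tower_x1_nonconst : nonconst p (x 1%N).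
Proof. exact: (x1_nonconst charO (j := cst) tower_x1_transcendental). Qed.

(** Induction along the tree, carrying non-constancy from x_1 to all nodes. *)
Lemma node_parent c : Kminus_seq c -> exists w, [/\ nonconst p w, wp p (node c) = g p w &
  w = x 1%N \/ exists c' xi, [/\ c = rcons c' xi, Kminus_seq c',
    xi \in Kminus p K & w = node c' + cst xi]].
Proof.
elim/last_ind: c => [|c xi IHc] Kc.
  by exists (x 1%N); split; [exact: tower_x1_nonconst|exact: node_nil|left].
have [Kc' Kxi] := Kminus_rconsP Kc; have [w [ncw Dw _]] := IHc Kc'.
exists (node c + cst xi); split; [|exact: node_step|by right; exists c, xi].
apply: (nonconstD charO); first exact: (Kminus_exp cst).
exact: nonconst_step charO _ _ ncw Dw.
Qed.

Lemma node_nonconst c : Kminus_seq c -> nonconst p (node c).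
Proof. by case/node_parent=> w [ncw Dw _]; apply: nonconst_step charO _ _ ncw Dw. Qed.

Section Descent.
Variables (M : set Omega) (sM : is_subfield M) (sFM : range iota `<=` M).
Variables (beta : K) (Kbeta : beta \in Kminus p K) (nz_beta : beta != 0).

Let Mcst a : M (cst a). Proof. by apply: sFM; exists (ratfun_C a). Qed.

Lemma wp_mem a : M a -> M (wp p a).
Proof. by move=> Ma; apply: subfieldD => //; apply: subfieldX. Qed.

Lemma descent_step c : Kminus_seq c ->
  M (node (rcons c 0)) -> M (node (rcons c beta)) -> M (node c).
Proof.
move=> Kc M0 Mb.
apply: (g_step_descent charO p_odd sM (b := cst beta)) => //.
- exact: (Kminus_exp cst).
- by rewrite fmorph_eq0.
- exact: node_nonconst.
- have := wp_mem M0; rewrite node_step ?rmorph0 ?addr0 //; exact: Kminus0.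
- by have := wp_mem Mb; rewrite node_step.
Qed.

(** The given nodes yield their parents by [descent_step], and so on down to
    the root. The remaining nodes of length [n.+1] then come from
    [g_step_span], which involves the parent of their parent. *)
Lemma descent n :
    (forall c xi, Kminus_seq c -> size c = n -> xi \in [:: 0; beta] ->
       M (node (rcons c xi))) ->
  forall c, Kminus_seq c -> (size c <= n.+1)%N -> M (node c).
Proof.
move=> MG.
have low k c : Kminus_seq c -> (size c + k = n)%N -> M (node c).
  elim: k c => [|k IHk] c Kc szc.
    by apply: descent_step => //; apply: MG; rewrite ?inE ?eqxx ?orbT // -szc addn0.
  by apply: descent_step => //; apply: IHk; rewrite ?size_rcons ?addSnnS //;
    apply: Kminus_rcons => //; apply: Kminus0.
move=> c Kc; rewrite leq_eqVlt => /orP[/eqP szc|]; last first.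
  by rewrite ltnS => lecn; apply: (low (n - size c)%N) => //; rewrite subnKC.
case/lastP: c Kc szc => // c xi /Kminus_rconsP[Kc Kxi].
rewrite size_rcons => -[szc].
have [w [ncw Dw parw]] := node_parent Kc.
have Mw : M w.
  case: parw => [->|[c' [zeta [Dc Kc' Kz ->]]]].
    by apply: sFM; case: x_tower => -> _; exists (ratfun_X K).
  apply: subfieldD => //; apply: (low 1%N) => //.
  by rewrite -szc Dc size_rcons addn1.
apply: (@g_step_span p K cardK Omega charO cst M (cst beta) (node c) w
  (node (rcons c 0)) (node (rcons c beta)) _ xi) => //.
- by move=> _ [a _ <-].
- exact: (Kminus_exp cst).
- by rewrite fmorph_eq0.
- by apply: MG; rewrite ?inE ?eqxx.
- rewrite node_step ?rmorph0 ?addr0 //; exact: Kminus0.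
- by apply: MG; rewrite ?inE ?eqxx ?orbT.
- exact: node_step.
- exact: node_step.
Qed.

Lemma level_sub k : (forall c, Kminus_seq c -> size c = k -> M (node c)) ->
  level k `<=` M.
Proof. by move=> Mk _ [d [Kd szd [xi _ ->]]]; apply: subfieldD => //; apply: Mk. Qed.

End Descent.

(** Enumerates the sequences over K_-, in order to bound the size of a level. *)
Fixpoint words k : seq (seq K) :=
  if k is k'.+1 then [seq rcons d xi | d <- words k', xi <- enum (Kminus p K)]
  else [:: [::]].

Lemma mem_words k d : (d \in words k) <-> Kminus_seq d /\ size d = k.
Proof.
elim: k d => [|k IHk] d /=.
  rewrite inE; split=> [/eqP->|[_ /eqP/nilP->]] //; by split.
split=> [/allpairsP[[c xi] /= [/IHk[Kc szc] Kxi ->]]|[]].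
  by rewrite mem_enum in Kxi; rewrite size_rcons szc; split; first exact: Kminus_rcons.
case/lastP: d => // c xi /Kminus_rconsP[Kc Kxi]; rewrite size_rcons => -[szc].
by apply: allpairs_f; rewrite ?mem_enum //; apply/IHk.
Qed.

Lemma size_Kminus : (size (enum (Kminus p K)) <= p)%N.
Proof.
have p_gt1 := prime_gt1 p_prime.
have szq : size ('X^p + 'X : {poly K}) = p.+1.
  by rewrite size_polyDl ?size_polyXn // size_polyX ltnS.
rewrite -ltnS -szq; apply: max_poly_roots; last exact: enum_uniq.
  by rewrite -size_poly_eq0 szq.
by apply/allP => a; rewrite mem_enum inE rootE !hornerE addr_eq0.
Qed.

Lemma size_words k : (size (words k) <= p ^ k)%N.
Proof.
elim: k => //= k IHk; rewrite size_allpairs expnSr.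
exact: leq_mul IHk size_Kminus.
Qed.

Definition level_seq k := [seq node d + cst xi | d <- words k, xi <- enum (Kminus p K)].

Lemma mem_level_seq k t : t \in level_seq k <-> level k t.
Proof.
split=> [/allpairsP[[d xi] /= [/mem_words[Kd szd] Kxi ->]]|].
  by exists d; split=> //; exists xi => //; rewrite mem_enum in Kxi.
case=> d [Kd szd [xi Kxi ->]]; apply: allpairs_f; rewrite ?mem_enum //.
exact/mem_words.
Qed.

Lemma size_level_seq k : (size (level_seq k) <= p ^ k.+1)%N.
Proof. by rewrite size_allpairs expnSr leq_mul ?size_words ?size_Kminus. Qed.

Section Generators.
Hypothesis sepcl : separable_closure iota.
Variables (beta : K) (Kbeta : beta \in Kminus p K) (nz_beta : beta != 0).
Variable n : nat.

Let G : set Omega := [set node (rcons c xi) | c in [set c : seq K |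
                    size c = n /\ {subset c <= Kminus p K}]
                  & xi in [set 0; beta]].

Lemma generators_sub (M : set Omega) : is_subfield M -> range iota `<=` M ->
  G `<=` M -> forall k, (k <= n.+1)%N -> level k `<=` M.
Proof.
move=> sM sFM sGM k lek; apply: level_sub => // c Kc szc.
apply: (descent sM sFM Kbeta nz_beta (n := n)) => // [d xi Kd szd|]; last by rewrite szc.
rewrite !inE => Dxi; apply: sGM; exists d => //; exists xi => //.
by case/orP: Dxi => /eqP->; [left|right].
Qed.

Lemma generators_level : G `<=` level n.+1.
Proof.
move=> _ [c [szc Kc] [xi Dxi <-]]; rewrite -szc -(size_rcons c xi).
by apply/level_node/Kminus_rcons => //; case: Dxi => ->; first exact: Kminus0.
Qed.

(** Let [s] be an embedding sending an element [y] of the generated field to a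
    conjugate [r]. It fixes x_1 and the constants, so by induction along the
    tree it maps the nodes of each length into their level. The elements whose
    image lies in the generated field thus form a subfield that contains the
    generators, hence [y]. *)
Lemma normal_generators : normal_over iota (adjoin iota G).
Proof.
move=> q irr_q [y Fy qy].
have sepq := irreducible_separable sepcl irr_q qy.
have [rs _ Dq] : exists2 rs, uniq rs & map_poly iota q %= \prod_(r <- rs) ('X - r%:P).
  by apply: (separable_splits sepcl); rewrite separable_map.
exists rs => // r rs_r.
have qr : root (map_poly iota q) r by rewrite (eqp_root Dq) root_prod_XsubC.
pose l := level_seq n.+1; set F := adjoin iota G in Fy *.
have sF : is_subfield F by apply: adjoin_subfield.
have sFF : range iota `<=` F by move=> _ [a _ <-]; apply: adjoin_iota.
pose D := adjoin iota [set` l].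
have sD : is_subfield D by apply: adjoin_subfield.
have sFD : range iota `<=` D by move=> _ [a _ <-]; apply: adjoin_iota.
have sGD : G `<=` D.
  by move=> t /generators_level/mem_level_seq lt; apply: sub_adjoin.
have sFDD : F `<=` D by apply: adjoin_min.
have [s emb <-] := embedding_extension sepcl ratfun_infinite (sFDD _ Fy) irr_q qy qr.
have Dlevel := generators_sub sD sFD sGD.
have Flevel := generators_sub sF sFF (@sub_adjoin _ _ iota G).
have s_x1 : s (x 1%N) = x 1%N by case: x_tower => -> _; apply: embeds_iota emb _.
have s_cst a : s (cst a) = cst a by apply: embeds_iota emb _.
have Dcst a : D (cst a) by apply: sFD; exists (ratfun_C a).
have s_level c : Kminus_seq c -> (size c <= n.+1)%N -> level (size c) (s (node c)).
  elim/last_ind: c => [|c xi IHc] Kc; rewrite ?size_rcons => szc.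
    apply: level0; rewrite -s_x1; apply: (embeds_step sD emb); last exact: node_nil.
      by apply: (Dlevel 0%N) => //; apply: (@level_node [::]).
    by apply: sFD; case: x_tower => -> _; exists (ratfun_X K).
  have [Kc' Kxi] := Kminus_rconsP Kc.
  have Dc : D (node c) by apply: (Dlevel (size c)) (ltnW szc) _ (level_node Kc').
  apply: (levelS (t := s (node c) + cst xi)).
    by apply: levelD => //; apply: IHc => //; apply: ltnW.
  rewrite -{1}s_cst -(embedsD sD emb) //; apply: (embeds_step sD emb).
  - by apply: (Dlevel _ _ _ (level_node Kc)); rewrite size_rcons.
  - exact: (subfieldD sD).
  - exact: node_step.
have sub_pre : F `<=` [set w | D w /\ F (s w)].
  apply: adjoin_min; first exact: (embeds_preimage_subfield sD emb sF).
    move=> w Fw; split; first exact: sFD.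
    by case: Fw => a _ <-; rewrite (embeds_iota emb); apply: sFF; exists a.
  move=> w Gw; split; first exact: sGD.
  case: Gw => c [szc Kc] [xi Dxi <-].
  apply: (Flevel n.+1) => //; rewrite -szc -(size_rcons c xi).
  apply: s_level; rewrite ?size_rcons ?szc //; apply: Kminus_rcons => //.
  by case: Dxi => ->; first exact: Kminus0.
by case: (sub_pre _ Fy).
Qed.

Lemma galois_generators : galois_over iota (adjoin iota G).
Proof.
split; last exact: normal_generators.
  by split; [apply: adjoin_subfield|move=> _ [a _ <-]; apply: adjoin_iota].
by move=> y _; case: sepcl => + _; apply.
Qed.

Lemma T_sub_generators : T iota x n.+3 `<=` adjoin iota G.
Proof.
have sF := adjoin_subfield iota G.
have sFF : range iota `<=` adjoin iota G by move=> _ [a _ <-]; apply: adjoin_iota.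
apply: smallest_sub => // _ [[a _ <-]|[i /= /andP[i_gt0 lei] <-]].
  by apply: sFF; exists (ratfun_C a).
case: i i_gt0 lei => [|[|i]] // _ lei.
  by apply: sFF; case: x_tower => -> _; exists (ratfun_X K).
exact: (generators_sub sF sFF (@sub_adjoin _ _ iota G) (k := i)) (level_x i).
Qed.

(** An embedding sending x_(k+2) to [r] maps x_2, ..., x_(k+2) to a sequence
    that satisfies the same equations, starting from the same x_1. *)
Lemma conjugates_of_x k q r : irreducible_poly q -> root (map_poly iota q) (x k.+2) ->
  root (map_poly iota q) r -> level k r.
Proof.
move=> irr_q qx qr; pose l := mkseq (fun i => x i.+2) k.+1.
pose D := adjoin iota [set` l].
have sD : is_subfield D by apply: adjoin_subfield.
have Dx i : (i <= k)%N -> D (x i.+2).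
  move=> lei; apply: sub_adjoin; apply/mapP; exists i => //.
  by rewrite mem_iota.
have [s emb <-] := embedding_extension sepcl ratfun_infinite (Dx k (leqnn k)) irr_q qx qr.
have s_x1 : s (x 1%N) = x 1%N by case: x_tower => -> _; apply: embeds_iota emb _.
have Dx1 : D (x 1%N) by case: x_tower => -> _; apply: adjoin_iota.
suff: forall i, (i <= k)%N -> level i (s (x i.+2)) by apply.
elim=> [|i IHi] lei.
  apply: level0; rewrite -s_x1.
  by apply: (embeds_step sD emb) => //; [exact: Dx|exact: x_step].
apply: (levelS (IHi (ltnW lei))).
exact: (embeds_step sD emb (Dx _ lei) (Dx _ (ltnW lei)) (x_step (ltn0Sn _))).
Qed.

(** The minimal polynomial of x_(k+2) is separable of degree at least p^(k+1),
    so it has at least that many distinct roots. They belong to [M] by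
    normality and to level [k] by [conjugates_of_x]; as the level has at most
    p^(k+1) elements, they exhaust it. *)
Lemma level_sub_galois k (M : set Omega) :
  galois_over iota M -> M (x k.+2) -> level k `<=` M.
Proof.
move=> [_ _ norM] Mx.
have [q [irr_q sep_q qx]] := elt_separable sepcl (x k.+2).
have [rs Mrs Dq] := norM q irr_q (ex_intro2 (fun y => M y) (fun y => root _ y) _ Mx qx).
have uniq_rs : uniq rs.
  by rewrite -separable_prod_XsubC -(eqp_separable Dq) separable_map.
have sub_rs : {subset rs <= level_seq k}.
  move=> r rs_r; apply/mem_level_seq/(conjugates_of_x irr_q qx).
  by rewrite (eqp_root Dq) root_prod_XsubC.
have szrs : (size (level_seq k) <= size rs)%N.
  apply: leq_trans (size_level_seq k) _; rewrite -ltnS -(size_prod_XsubC rs id).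
  rewrite -(eqp_size Dq) size_map_poly; apply: tower_degree => //.
  exact: separable_poly_neq0.
have [_ eq_rs] := uniq_min_size uniq_rs sub_rs szrs.
by move=> t /mem_level_seq; rewrite -eq_rs; apply: Mrs.
Qed.

Lemma galois_closure_generators :
  galois_closure iota (T iota x n.+3) = adjoin iota G.
Proof.
apply/seteqP; split; last first.
  move=> t Ft M [galM sTM]; have [[sM sFM] _ _] := galM.
  have Mx : M (x n.+3).
    by apply: sTM; apply: sub_gen_smallest; right; exists n.+3 => //=; rewrite leqnn.
  apply: (adjoin_min sM sFM) Ft => w /generators_level.
  exact: level_sub_galois galM Mx w.
by apply: smallest_sub; [exact: galois_generators|exact: T_sub_generators].
Qed.

End Generators.
End Tower.

Theorem proposition2p2 (p : nat) (p_prime : prime p) (p_odd : odd p)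
    (K : finFieldType) (cardK : #|K| = (p ^ 2)%N)
    (Omega : fieldType) (iota : {rmorphism ratfun K -> Omega})
    (sepcl : separable_closure iota)
    (x : nat -> Omega) (x_tower : tower_seq p iota x)
    (u : seq K -> Omega) (u_fam : u_family p iota x u)
    (n : nat) (n_gt0 : (0 < n)%N)
    (beta : K) (betaK : beta \in Kminus p K) (beta_neq0 : beta != 0) :
  galois_closure iota (T iota x (n + 2)) =
  adjoin iota [set u (rcons c xi) | c in [set c : seq K |
                    size c = (n - 1)%N /\ {subset c <= Kminus p K}]
                  & xi in [set 0; beta]].
Proof.
case: n n_gt0 => // n _; rewrite subn1 addn2 /=.
rewrite (galois_closure_generators p_prime p_odd cardK x_tower u_fam sepcl betaK beta_neq0).
congr (adjoin iota _); apply/seteqP; split=> _ [c Gc [xi Gxi <-]];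
  by exists c => //; exists xi => //; rewrite node_rcons.
Qed.
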